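(* Let $n\ge 4$ be an integer, and let $w,u:[n]^{(2)}\to\mathbb R$ satisfy $w([n])=u([n])=0$. Then $\operatorname{disc}(w,u)=0$ if and only if all three of the following conditions hold: (i) $h_w^+=0$ or $h_u^+=0$; (ii) $h_w^-=0$ or $h_u^-=0$; (iii) $\operatorname{tr}(\Gamma_w\Gamma_u)=0$, equivalently $\operatorname{col}(\Gamma_w)\perp\operatorname{col}(\Gamma_u)$ in $\mathbb R^2$. Consequently, if $\mathcal F$ is a pairwise zero-discrepant family of nonzero centered weight functions on $[n]$, then $$\sum_{w\in\mathcal F}\Bigl(\operatorname{rank}(\Gamma_w)+\mathbf 1_{\{h_w^+\ne0\}}+\mathbf 1_{\{h_w^-\ne0\}}\Bigr)\le 4,$$ and hence $|\mathcal F|\le 4$.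
   Context: Write $[n]=\{1,\dots,n\}$ and $[n]^{(2)}=\{(x,y)\in[n]\times[n]:x\ne y\}$. A weight function on $[n]$ is a function $w:[n]^{(2)}\to\mathbb R$, with values written $w_{xy}$ or $w(x,y)$. Put $\langle w,u\rangle=\sum_{x\ne y}w_{xy}u_{xy}$, $w([n])=\sum_{x\ne y}w_{xy}$, $d(w)=w([n])/(n(n-1))$; $w$ is centered if $w([n])=0$. For $\pi\in S_n$ the relabelling $w_\pi$ is $(w_\pi)_{xy}=w_{\pi^{-1}(x)\pi^{-1}(y)}$. Define $$\operatorname{disc}^+(w,u)=\max_{\pi\in S_n}\langle w_\pi,u\rangle-d(w)d(u)n(n-1),\qquad \operatorname{disc}^-(w,u)=d(w)d(u)n(n-1)-\min_{\pi\in S_n}\langle w_\pi,u\rangle,$$ and $\operatorname{disc}(w,u)=\max\{\operatorname{disc}^+(w,u),\operatorname{disc}^-(w,u)\}$. A family (set) $\mathcal F$ of weight functions is pairwise zero-discrepant if $\operatorname{disc}(w,u)=0$ for all distinct $w,u\in\mathcal F$. For $x\in[n]$ let $r_x(w)=\sum_{y\ne x}w_{xy}$, $c_x(w)=\sum_{y\ne x}w_{yx}$, $$p_x(w)=\frac{r_x(w)+c_x(w)}{2(n-2)},\qquad q_x(w)=\frac{r_x(w)-c_x(w)}{2n}.$$ For $x\ne y$ let $g_w^+(x,y)=p_x(w)+p_y(w)$, $g_w^-(x,y)=q_x(w)-q_y(w)$, and $h_w=w-g_w^+-g_w^-$. With $f^{\mathsf T}(x,y)=f(y,x)$, let $h_w^+=(h_w+h_w^{\mathsf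 T})/2$ and $h_w^-=(h_w-h_w^{\mathsf T})/2$. For centered $w$ let $\alpha_w=\sqrt{2(n-2)}\,(p_1(w),\dots,p_n(w))\in\mathbb R^n$, $\beta_w=\sqrt{2n}\,(q_1(w),\dots,q_n(w))\in\mathbb R^n$, and $$\Gamma_w=\begin{pmatrix}\|\alpha_w\|_2^2&\langle\alpha_w,\beta_w\rangle\\ \langle\alpha_w,\beta_w\rangle&\|\beta_w\|_2^2\end{pmatrix}.$$ $\operatorname{col}(\Gamma)$ denotes the column space of the matrix $\Gamma$, and $\mathbf 1_{\{\cdot\}}$ is $1$ if the condition holds and $0$ otherwise. *)

(* Defs.v *)
From HB Require Import structures.
From mathcomp Require Import all_boot all_order all_algebra all_fingroup.
From mathcomp Require Import boolp classical_sets cardinality fsbigop reals.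

Set Implicit Arguments.
Unset Strict Implicit.
Unset Printing Implicit Defensive.

Import Order.TTheory GRing.Theory Num.Theory.
Local Open Scope ring_scope.

(* The index set [n] = {1, ..., n} is represented by 'I_n. *)
Notation offdiag n := {e : 'I_n * 'I_n | e.1 != e.2}.

Notation weight R n := {ffun offdiag n -> R}.

Section Weights.
Variables (R : realType) (n : nat).
Implicit Types (w u f : weight R n) (x y : 'I_n) (s : 'S_n).

(* w_xy. The value 0 on the diagonal is a placeholder: the definitions below
   only use [wval w x y] for x != y. *)
Definition wval w x y : R :=
  if insub (x, y) is Some e then w e else 0.

Definition mkweight (F : 'I_n -> 'I_n -> R) : weight R n :=
  [ffun e => F (val e).1 (val e).2].

Definition wdot w u : R :=
  \sum_x \sum_(y | y != x) wval w x y * wval u x y.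

Definition wtotal w : R := \sum_x \sum_(y | y != x) wval w x y.

Definition density w : R := wtotal w / (n%:R * (n%:R - 1)).

Definition centered w : Prop := wtotal w = 0.

Definition relabel s w : weight R n :=
  mkweight (fun x y => wval w (s^-1%g x) (s^-1%g y)).

(* The value at the identity permutation serves as the default of the iterated
   max and min, so these are the max and the min over the whole of 'S_n. *)
Definition disc_plus w u : R :=
  \big[Num.max/wdot (relabel 1%g w) u]_(s : 'S_n) wdot (relabel s w) u
  - density w * density u * (n%:R * (n%:R - 1)).

Definition disc_minus w u : R :=
  density w * density u * (n%:R * (n%:R - 1))
  - \big[Num.min/wdot (relabel 1%g w) u]_(s : 'S_n) wdot (relabel s w) u.

Definition disc w u : R := Num.max (disc_plus w u) (disc_minus w u).

Definition pairwise_zero_discrepant (F : set (weight R n)) : Prop :=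
  forall w u, F w -> F u -> w != u -> disc w u = 0.

Definition rowsum w x : R := \sum_(y | y != x) wval w x y.

Definition colsum w x : R := \sum_(y | y != x) wval w y x.

Definition pcoef w x : R := (rowsum w x + colsum w x) / (2 * (n%:R - 2)).

Definition qcoef w x : R := (rowsum w x - colsum w x) / (2 * n%:R).

Definition gplus w : weight R n := mkweight (fun x y => pcoef w x + pcoef w y).

Definition gminus w : weight R n := mkweight (fun x y => qcoef w x - qcoef w y).

Definition wtr f : weight R n := mkweight (fun x y => wval f y x).

Definition hpart w : weight R n := w - gplus w - gminus w.

Definition hplus w : weight R n :=
  mkweight (fun x y => (wval (hpart w) x y + wval (wtr (hpart w)) x y) / 2).

Definition hminus w : weight R n :=
  mkweight (fun x y => (wval (hpart w) x y - wval (wtr (hpart w)) x y) / 2).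

Definition alpha w : 'cV[R]_n :=
  Num.sqrt (2 * (n%:R - 2)) *: \col_x pcoef w x.

Definition beta w : 'cV[R]_n :=
  Num.sqrt (2 * n%:R) *: \col_x qcoef w x.

End Weights.

Section Euclidean.
Variable R : realType.

Definition vdot m (a b : 'cV[R]_m) : R := \sum_i a i 0 * b i 0.

(* The library norm on matrices is the sup norm. *)
Definition norm2 m (a : 'cV[R]_m) : R := Num.sqrt (\sum_i a i 0 ^+ 2).

Definition colspace m k (G : 'M[R]_(m, k)) : set 'cV[R]_m :=
  [set v | exists z : 'cV[R]_k, v = G *m z]%classic.

Definition orthogonal_sets m (A B : set 'cV[R]_m) : Prop :=
  forall a b, A a -> B b -> vdot a b = 0.

Definition Gamma n (w : weight R n) : 'M[R]_2 :=
  \matrix_(i, j)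
    if i == 0
    then if j == 0 then norm2 (alpha w) ^+ 2 else vdot (alpha w) (beta w)
    else if j == 0 then vdot (alpha w) (beta w) else norm2 (beta w) ^+ 2.

End Euclidean.

(* Main.v *)
Require Import Defs.
From HB Require Import structures.
From mathcomp Require Import all_boot all_order all_algebra all_fingroup.
From mathcomp Require Import boolp classical_sets cardinality fsbigop reals.
From mathcomp Require Import finmap ring lra.

(* For centered w and u, disc(w, u) = 0 iff <w_s, u> = 0 for every permutation
   s, and the orthogonality of the three parts of the decomposition gives
   <w_s, u> = sum_x K(s^-1 x, x) + <(h_w)_s, h_u>, where
   K(x, y) = alpha_w(x) alpha_u(y) + beta_w(x) beta_u(y).
   Applying (1 - (a b))(1 - (c d)) to w leaves only the entries between {a, b}
   and {c, d}, given up to sign by the two cross differences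
   t = w_ac - w_bc - w_ad + w_bd and t' = w_ca - w_da - w_cb + w_db.
   Pairing with all relabellings of u gives t_w t_u + t'_w t'_u = 0 and, after
   exchanging the two pairs in u, t_w t'_u + t'_w t_u = 0; hence
   (t_w + t'_w)(t_u + t'_u) = (t_w - t'_w)(t_u - t'_u) = 0 for all quadruples.
   A symmetric or antisymmetric function with zero row and column sums is
   determined by its cross differences, which gives (i) and (ii).  What remains,
   sum_x K(s^-1 x, x) = 0 for all s, forces K = 0 because K has zero row and
   column sums, and tr(Gamma_w Gamma_u) is the sum of the squares of K.
   In a pairwise zero-discrepant family the symmetric matrices Gamma_w have
   pairwise zero products, so their row spaces form a direct sum in R^2. *)

Set Implicit Arguments.
Unset Strict Implicit.
Unset Printing Implicit Defensive.

Import Order.TTheory GRing.Theory Num.Theory.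
Local Open Scope ring_scope.

(** Induction on [s]: composing [p] with the transposition of [p x] and [y] corrects the value at
    [x] and keeps the others, which avoid both points. *)
Lemma perm_map_seq (T : finType) (s t : seq T) :
  uniq s -> uniq t -> size s = size t -> exists p : {perm T}, map p s = t.
Proof.
elim: s t => [|x s IH] [|y t] //=; first by exists 1%g.
move=> /andP[xs us] /andP[yt ut] [est].
have [p ep] := IH t us ut est.
exists (p * tperm (p x) y)%g; rewrite permM tpermL -[in RHS]ep; congr cons.
apply/eq_in_map => z zs; rewrite permM tpermD //.
  by rewrite (inj_eq perm_inj); apply: contraNneq xs => ->.
by apply: contraNneq yt => ->; rewrite -ep map_f.
Qed.

(** * Degree parts and remainder of a weight *)

Section Decomposition.
Variables (R : realType) (n : nat).
Implicit Types (w u : weight R n) (x y : 'I_n) (s : 'S_n).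

Lemma wval_diag w x : wval w x x = 0.
Proof. by rewrite /wval insubF //= eqxx. Qed.

Lemma wval_mk (F : 'I_n -> 'I_n -> R) x y :
  x != y -> wval (mkweight F) x y = F x y.
Proof. by move=> xy; rewrite /wval insubT ffunE. Qed.

Lemma wval_inj w u :
  (forall x y, x != y -> wval w x y = wval u x y) -> w = u.
Proof.
move=> e; apply/ffunP => -[[x y] xy].
by have := e x y xy; rewrite /wval !insubT.
Qed.

Lemma wval0 x y : wval (0 : weight R n) x y = 0.
Proof. by rewrite /wval; case: insubP => // *; rewrite ffunE. Qed.

Lemma wvalB w u x y : wval (w - u) x y = wval w x y - wval u x y.
Proof. by rewrite /wval; case: insubP => [*|_]; rewrite ?ffunE ?subr0. Qed.

Lemma sum_offdiag (F : 'I_n -> R) x :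
  \sum_(y | y != x) F y = \sum_y F y - F x.
Proof. by rewrite [in RHS](bigD1 x) //= [F x + _]addrC addrK. Qed.

Lemma wdotE w u : wdot w u = \sum_x \sum_y wval w x y * wval u x y.
Proof.
by apply: eq_bigr => x _; rewrite sum_offdiag wval_diag mul0r subr0.
Qed.

Lemma wtotalE w : wtotal w = \sum_x \sum_y wval w x y.
Proof. by apply: eq_bigr => x _; rewrite sum_offdiag wval_diag subr0. Qed.

Lemma rowsumE w x : rowsum w x = \sum_y wval w x y.
Proof. by rewrite /rowsum sum_offdiag wval_diag subr0. Qed.

Lemma colsumE w x : colsum w x = \sum_y wval w y x.
Proof. by rewrite /colsum sum_offdiag wval_diag subr0. Qed.

Lemma wval_relabel s w x y :
  wval (relabel s w) x y = wval w (s^-1%g x) (s^-1%g y).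
Proof.
have [->|xy] := eqVneq x y; first by rewrite !wval_diag.
by rewrite wval_mk.
Qed.

(** With d(w) = 0 the discrepancy is the larger of the maximum and minus the minimum of the
    pairings; if it is 0, each pairing is both <= 0 and >= 0. *)
Lemma disc_eq0 w u : centered w ->
  disc w u = 0 <-> forall s, wdot (relabel s w) u = 0.
Proof.
move=> cw; rewrite /disc /disc_plus /disc_minus /density cw !mul0r subr0 sub0r.
split=> [e s|e].
  apply/eqP; rewrite eq_le; apply/andP; split.
    by rewrite -e le_max; apply/orP; left; apply: le_bigmax.
  rewrite -oppr_le0 -e le_max; apply/orP; right.
  by rewrite lerN2; apply: bigmin_le.
by rewrite !e !(eq_bigr _ (fun s _ => e s)) !big_const !iter_fix ?maxxx ?minxx
  ?oppr0 ?maxxx.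
Qed.

Hypothesis hn : (4 <= n)%N.

Lemma natr_ge4 : 4 <= n%:R :> R.
Proof. by rewrite (ler_nat R 4 n). Qed.

Lemma rowsum_pq w x : rowsum w x = (n%:R - 2) * pcoef w x + n%:R * qcoef w x.
Proof.
have n4 := natr_ge4; rewrite /pcoef /qcoef; field.
by apply/andP; split; apply: lt0r_neq0; lra.
Qed.

Lemma colsum_pq w x : colsum w x = (n%:R - 2) * pcoef w x - n%:R * qcoef w x.
Proof.
have n4 := natr_ge4; rewrite /pcoef /qcoef; field.
by apply/andP; split; apply: lt0r_neq0; lra.
Qed.

Lemma sum_rowsum w : \sum_x rowsum w x = wtotal w.
Proof. by []. Qed.

Lemma sum_colsum w : \sum_x colsum w x = wtotal w.
Proof.
under eq_bigr => x _ do rewrite colsumE.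
by rewrite exchange_big wtotalE.
Qed.

Lemma sum_pcoef w : centered w -> \sum_x pcoef w x = 0.
Proof.
move=> cw; rewrite -mulr_suml big_split /= sum_rowsum sum_colsum cw.
by rewrite addr0 mul0r.
Qed.

Lemma sum_qcoef w : \sum_x qcoef w x = 0.
Proof. by rewrite -mulr_suml sumrB sum_rowsum sum_colsum subrr mul0r. Qed.

Lemma wval_hpart w x y : x != y -> wval (hpart w) x y =
  wval w x y - (pcoef w x + pcoef w y) - (qcoef w x - qcoef w y).
Proof. by move=> xy; rewrite !wvalB !wval_mk. Qed.

(** As the p and the q sum to 0, row x of g^+ sums to (n-1)p_x - p_x and row x of g^- to (n-1)q_x +
    q_x; by [rowsum_pq] these add up to the row sum of w. *)
Lemma hpart_rowsum w x : centered w -> \sum_y wval (hpart w) x y = 0.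
Proof.
move=> cw; rewrite -rowsumE /rowsum.
under eq_bigr => y yx do rewrite wval_hpart 1?eq_sym //.
rewrite !sumrB big_split /= sum_offdiag wval_diag -rowsumE rowsum_pq.
rewrite !sum_offdiag !big_const_ord !iter_addr_0 sum_pcoef // sum_qcoef.
by ring.
Qed.

Lemma hpart_colsum w y : centered w -> \sum_x wval (hpart w) x y = 0.
Proof.
move=> cw; rewrite -colsumE /colsum.
under eq_bigr => x yx do rewrite wval_hpart //.
rewrite !sumrB big_split /= sum_offdiag wval_diag -colsumE colsum_pq.
rewrite !sum_offdiag !big_const_ord !iter_addr_0 sum_pcoef // sum_qcoef.
by ring.
Qed.

(** The kernel K as a matrix. *)
Definition gram w u : 'M[R]_n :=
  alpha w *m (alpha u)^T + beta w *m (beta u)^T.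

Lemma gramE w u x y : gram w u x y =
  2 * (n%:R - 2) * (pcoef w x * pcoef u y) + 2 * n%:R * (qcoef w x * qcoef u y).
Proof.
have n4 := natr_ge4.
have a0 : 0 <= 2 * (n%:R - 2) :> R by lra.
have b0 : 0 <= 2 * n%:R :> R by lra.
rewrite !mxE !big_ord1 !mxE -[in RHS](sqr_sqrtr a0) -[in RHS](sqr_sqrtr b0).
by ring.
Qed.

(** Pairing with a separable function f(x) + g(y) sees only row and column sums; g^+ + g^- is of
    this form. *)
Lemma sum_mul_sep (M : 'I_n -> 'I_n -> R) (f g : 'I_n -> R) :
  \sum_x \sum_y M x y * (f x + g y) =
  \sum_x (f x * \sum_y M x y + g x * \sum_y M y x).
Proof.
under eq_bigr => x _ do
  (under eq_bigr => y _ do rewrite mulrDr; rewrite big_split).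
rewrite big_split big_split /=; congr (_ + _).
  apply: eq_bigr => x _; rewrite mulr_sumr.
  by apply: eq_bigr => y _; rewrite mulrC.
rewrite exchange_big; apply: eq_bigr => x _; rewrite mulr_sumr.
by apply: eq_bigr => y _; rewrite mulrC.
Qed.

Definition hdot s w u : R := \sum_x \sum_y
  wval (hpart w) (s^-1%g x) (s^-1%g y) * wval (hpart u) x y.

Lemma wdot_relabel s w u : centered w -> centered u ->
  wdot (relabel s w) u = \sum_x gram w u (s^-1%g x) x + hdot s w u.
Proof.
move=> cw cu; rewrite wdotE.
set t := (s^-1)%g.
(* f1(x) + g1(y) is the degree part of u, and f2(x) + g2(y) that of the relabelled w. *)
pose f1 x := pcoef u x + qcoef u x; pose g1 x := pcoef u x - qcoef u x.
pose f2 x := pcoef w (t x) + qcoef w (t x).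
pose g2 x := pcoef w (t x) - qcoef w (t x).
have -> : \sum_x \sum_y wval (relabel s w) x y * wval u x y =
    \sum_x \sum_y wval w (t x) (t y) * (f1 x + g1 y)
  + \sum_x \sum_y wval (hpart u) x y * (f2 x + g2 y) + hdot s w u.
  rewrite -!big_split; apply: eq_bigr => x _; rewrite -!big_split.
  apply: eq_bigr => y _; rewrite wval_relabel -/t /=.
  have [->|xy] := eqVneq x y; first by rewrite !wval_diag; ring.
  rewrite !wval_hpart ?(inj_eq perm_inj) // /f1 /f2 /g1 /g2; ring.
rewrite !sum_mul_sep [X in _ + X + _]big1 ?addr0; last first.
  by move=> x _; rewrite hpart_rowsum // hpart_colsum // !mulr0 addr0.
congr (_ + _); apply: eq_bigr => x _; rewrite gramE.
have -> : \sum_y wval w (t x) (t y) = rowsum w (t x).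
  by rewrite rowsumE [RHS](reindex_inj (@perm_inj _ t)).
have -> : \sum_y wval w (t y) (t x) = colsum w (t x).
  by rewrite colsumE [RHS](reindex_inj (@perm_inj _ t)).
by rewrite rowsum_pq colsum_pq /f1 /g1; ring.
Qed.

Lemma hplus_eq0 w : hplus w = 0 <->
  forall x y, wval (hpart w) x y + wval (hpart w) y x = 0.
Proof.
split=> [e x y|e].
  have [->|xy] := eqVneq x y; first by rewrite !wval_diag addr0.
  by have := wval0 x y; rewrite -e !wval_mk //; lra.
by apply: wval_inj => x y xy; rewrite wval0 !wval_mk // e mul0r.
Qed.

Lemma hminus_eq0 w : hminus w = 0 <->
  forall x y, wval (hpart w) x y = wval (hpart w) y x.
Proof.
split=> [e x y|e].
  have [->//|xy] := eqVneq x y.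
  by have := wval0 x y; rewrite -e !wval_mk //; lra.
by apply: wval_inj => x y xy; rewrite wval0 !wval_mk // e subrr mul0r.
Qed.

(* Symmetric and antisymmetric functions are orthogonal. *)
Lemma hdot_eq0 s w u : hplus w = 0 \/ hplus u = 0 ->
  hminus w = 0 \/ hminus u = 0 -> hdot s w u = 0.
Proof.
move=> hp hm; set t := (s^-1)%g.
pose A x y := wval (hpart w) (t x) (t y); pose B x y := wval (hpart u) x y.
have e : hdot s w u = \sum_x \sum_y A y x * B y x.
  by rewrite exchange_big.
(* Adding the sum to its transposed copy pairs each entry with its mirror image. *)
suff AB x y : A x y * B x y + A y x * B y x = 0.
  have : hdot s w u + hdot s w u = 0.
    rewrite {2}e /hdot -big_split big1 // => x _.
    by rewrite -big_split big1 // => y _; apply: AB.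
  by lra.
have {}hp : A x y = - A y x \/ B x y = - B y x.
  by case: hp => /hplus_eq0 hp; [left|right]; apply/eqP; rewrite -addr_eq0 hp.
have {}hm : A x y = A y x \/ B x y = B y x.
  by case: hm => /hminus_eq0 hm; [left|right]; apply: hm.
move: (A x y) (A y x) (B x y) (B y x) hp hm => a a' b b'.
(* If both alternatives concern the same function, its two entries are 0; otherwise the two products
   cancel. *)
case=> -> [] e3; [|by rewrite e3; ring|by rewrite e3; ring|].
- by rewrite (_ : a' = 0); [ring|lra].
- by rewrite (_ : b' = 0); [ring|lra].
Qed.

End Decomposition.

(** This is t; the companion t' is [crossdiff H c d a b]. *)
Definition crossdiff (T : Type) (R : zmodType) (H : T -> T -> R) a b c d : R :=
  H a c - H b c - H a d + H b d.

(** * Functions determined by their cross differences *)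

Section CrossDifferences.
Variables (R : realType) (n : nat) (H : 'I_n -> 'I_n -> R).
Hypothesis hn : (4 <= n)%N.
Hypothesis H0 : forall x, H x x = 0.
Hypothesis Hr : forall x, \sum_y H x y = 0.
Hypothesis Hc : forall y, \sum_x H x y = 0.
Hypothesis Hx : forall a b c d, uniq [:: a; b; c; d] -> crossdiff H a b c d = 0.

(** Sum the cross differences over all b: zero column sums leave n(H a c - H a d), and only b in {a,
    c, d} can contribute on the other side. *)
Lemma crossdiff_sum a c d : uniq [:: a; c; d] ->
  (n%:R - 3) * (H a c - H a d) = H a d + H c d - H a c - H d c.
Proof.
move=> u.
have z b : b \notin [:: a; c; d] -> H a c - H a d - H b c + H b d = 0.
  move=> bn; have := @Hx a b c d; rewrite /crossdiff => {1}<-; first by ring.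
  move: u bn; rewrite /= !inE !negb_or (eq_sym b).
  by case/and3P => /andP[-> ->] -> _ /and3P[-> -> ->].
have : \sum_b (H a c - H a d - H b c + H b d) =
  H a c - H a d - H a c + H a d + (H a c - H a d - H c c + H c d)
  + (H a c - H a d - H d c + H d d).
  rewrite (bigID (mem [:: a; c; d])) /= [X in _ + X]big1 // addr0.
  by rewrite -big_uniq // !big_cons big_nil /= addr0 addrA.
rewrite !big_split /= !sumrN !Hc !H0 !sumr_const card_ord => e.
by lra.
Qed.

(** By symmetry [crossdiff_sum] makes each row constant off the diagonal, and the row sum is 0. *)
Lemma crossdiff_sym_eq0 : (forall x y, H x y = H y x) -> forall x y, H x y = 0.
Proof.
move=> Hs a.
have n4 := natr_ge4 R hn.
have e c d : c != a -> d != a -> H a c = H a d.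
  move=> ca da; have [->//|cd] := eqVneq c d.
  have := @crossdiff_sum a c d; rewrite /= !inE negb_or eq_sym ca eq_sym da cd.
  rewrite (Hs d c) => /(_ isT) h.
  have : (n%:R - 2) * (H a c - H a d) = 0 by lra.
  by move/eqP; rewrite mulf_eq0 subr_eq0 => /orP[/eqP ?|/eqP//]; lra.
move=> y; have [<-//|ya] := eqVneq a y; rewrite 1?eq_sym in ya.
have := Hr a; rewrite (bigD1 a) //= H0 add0r.
rewrite (eq_bigr (fun=> H a y)); last by move=> z za; apply: e.
rewrite sum_offdiag sumr_const card_ord -(mulr_natl _ n) => h.
have : (n%:R - 1) * H a y = 0 by lra.
by move/eqP; rewrite mulf_eq0 => /orP[/eqP ?|/eqP//]; lra.
Qed.

(** With a third index a, [crossdiff_sum] at the three rotations of (a, c, d) is a linear system in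
    H a c, H a d, H c d. *)
Lemma crossdiff_antisym_eq0 :
  (forall x y, H x y = - H y x) -> forall x y, H x y = 0.
Proof.
move=> Hs c d.
have n4 := natr_ge4 R hn.
have [->|cd] := eqVneq c d; first exact: H0.
have [a /=] : exists a, a \notin [:: c; d].
  apply/existsP; rewrite -negb_forall; apply/negP => /forallP h.
  have : (size (enum 'I_n) <= size [:: c; d])%N.
    by apply: uniq_leq_size => [|x _]; [exact: enum_uniq|rewrite h].
  by rewrite size_enum_ord leqNgt (leq_trans _ hn).
rewrite !inE negb_or => /andP[ac ad].
have := @crossdiff_sum a c d; have := @crossdiff_sum c d a.
have := @crossdiff_sum d a c; rewrite /= !inE !negb_or.
rewrite (eq_sym d a) (eq_sym d c) (eq_sym c a) ac ad cd.
move=> /(_ isT) e1 /(_ isT) e2 /(_ isT) e3; move: e1 e2 e3.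
rewrite (Hs d a) (Hs d c) (Hs c a).
move: (H a c) (H a d) (H c d) => Y Z X e1 e2 e3.
(* The linear system e1, e2, e3 has determinant 2 n^2 (n - 3) up to sign. *)
have : (n%:R : R) * (Y - X) = 0 by lra.
move/eqP; rewrite mulf_eq0 subr_eq0 => /orP[/eqP ?|/eqP e]; first lra.
have : (n%:R : R) * ((n%:R - 3) * X) = 0 by nra.
by move/eqP; rewrite !mulf_eq0 => /orP[/eqP ?|/orP[/eqP ?|/eqP//]]; lra.
Qed.

End CrossDifferences.

(** * Testing relabellings with transpositions *)

Section Transpositions.
Variables (R : realType) (n : nat).

Lemma sum_indic_sub (F : 'I_n -> R) a b :
  \sum_x ((x == a)%:R - (x == b)%:R) * F x = F a - F b.
Proof.
under eq_bigr => x _ do rewrite mulrBl.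
rewrite sumrB (bigD1 a) //= [X in _ - X](bigD1 b) //= !eqxx !mul1r.
by rewrite !big1 ?addr0 // => x /negPf ->; rewrite mul0r.
Qed.

(** If one of the transpositions fixes both i and j, the four terms cancel in pairs; otherwise one
    index lies in {a, b} and the other in {c, d}. *)
Lemma crossdiff_tperm (H : 'I_n -> 'I_n -> R) a b c d i j :
  (forall x, H x x = 0) -> uniq [:: a; b; c; d] ->
  let t := tperm a b in let t' := tperm c d in
  H i j - H (t i) (t j) - H (t' i) (t' j) + H (t' (t i)) (t' (t j)) =
  crossdiff H a b c d *
    (((i == a)%:R - (i == b)%:R) * ((j == c)%:R - (j == d)%:R)) +
  crossdiff H c d a b *
    (((i == c)%:R - (i == d)%:R) * ((j == a)%:R - (j == b)%:R)).
Proof.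
move=> H0 + t t'; rewrite /= !inE !negb_or -!andbA andbT.
case/and5P => ab ac ad bc /andP[bd cd].
have ta : t a = b by rewrite tpermL.
have tb : t b = a by rewrite tpermR.
have tc : t c = c by rewrite tpermD.
have td : t d = d by rewrite tpermD.
have t'a : t' a = a by rewrite tpermD // eq_sym.
have t'b : t' b = b by rewrite tpermD // eq_sym.
have t'c : t' c = d by rewrite tpermL.
have t'd : t' d = c by rewrite tpermR.
rewrite /crossdiff.
have t'E x : x != c -> x != d -> t' x = x by move=> *; rewrite tpermD // eq_sym.
have tE x : x != a -> x != b -> t x = x by move=> *; rewrite tpermD // eq_sym.
have E := (negPf ab, negPf ac, negPf ad, negPf bc, negPf bd, negPf cd,
  eq_sym b a, eq_sym c a, eq_sym d a, eq_sym c b, eq_sym d b, eq_sym d c).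
(* Twenty-five cases: each of i and j is a, b, c, d or none of them. *)
have [->|ia] := eqVneq i a; [|have [->|ib] := eqVneq i b;
  [|have [->|ic] := eqVneq i c; [|have [->|id] := eqVneq i d]]];
(have [->|ja] := eqVneq j a; [|have [->|jb] := eqVneq j b;
  [|have [->|jc] := eqVneq j c; [|have [->|jd] := eqVneq j d]]]);
rewrite ?ta ?tb ?tc ?td ?(tE i) ?(tE j) //
  ?t'a ?t'b ?t'c ?t'd ?(t'E i) ?(t'E j) //;
rewrite ?eqxx ?E ?H0 /=; ring.
Qed.

Lemma crossdiff_mul (W U : 'I_n -> 'I_n -> R) a b c d a' b' c' d' :
  (forall x, W x x = 0) ->
  (forall s : 'S_n, \sum_x \sum_y W (s x) (s y) * U x y = 0) ->
  uniq [:: a; b; c; d] -> uniq [:: a'; b'; c'; d'] ->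
  crossdiff W a b c d * crossdiff U a' b' c' d' +
  crossdiff W c d a b * crossdiff U c' d' a' b' = 0.
Proof.
move=> W0 e uq uq'.
have [//|s [sa sb sc sd]] := perm_map_seq uq' uq.
pose t := tperm a b; pose t' := tperm c d.
(* With s carrying the primed quadruple to the unprimed one, this is an alternating sum of the
   vanishing pairings for s, st, st' and stt'. *)
have : \sum_x \sum_y (W (s x) (s y) - W (t (s x)) (t (s y))
   - W (t' (s x)) (t' (s y)) + W (t' (t (s x))) (t' (t (s y)))) * U x y = 0.
  pose S (g : 'S_n) := \sum_x \sum_y W (g x) (g y) * U x y.
  have S0 g : S g = 0 by exact: e.
  transitivity (S s - S (s * t)%g - S (s * t')%g + S (s * t * t')%g).
    rewrite /S -!sumrB -big_split; apply: eq_bigr => x _.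
    rewrite -!sumrB -big_split; apply: eq_bigr => y _.
    by rewrite !permM /=; ring.
  by rewrite !S0; ring.
have da x : (s x == a) = (x == a') by rewrite -sa (inj_eq perm_inj).
have db x : (s x == b) = (x == b') by rewrite -sb (inj_eq perm_inj).
have dc x : (s x == c) = (x == c') by rewrite -sc (inj_eq perm_inj).
have dd x : (s x == d) = (x == d') by rewrite -sd (inj_eq perm_inj).
pose A x : R := (x == a')%:R - (x == b')%:R.
pose C x : R := (x == c')%:R - (x == d')%:R.
under eq_bigr => x _.
  under eq_bigr => y _.
    rewrite crossdiff_tperm // !da !db !dc !dd -/(A x) -/(A y) -/(C x) -/(C y).
    rewrite mulrDl -!mulrA.
    over.
  rewrite big_split /= -!mulr_sumr !sum_indic_sub.
  over.
rewrite big_split /= -!mulr_sumr !sum_indic_sub => e0.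
by rewrite -[RHS]e0 /crossdiff; ring.
Qed.

(** Following s by a transposition changes only two summands, so M i a - M i b - M j a + M j b = 0;
    summing over j makes row i constant, and its sum is 0. *)
Lemma perm_trace_eq0 (M : 'I_n -> 'I_n -> R) :
  (forall s : 'S_n, \sum_x M (s x) x = 0) ->
  (forall x, \sum_y M x y = 0) -> (forall y, \sum_x M x y = 0) ->
  forall x y, M x y = 0.
Proof.
move=> Ms Mr Mc i a.
have n0 : n%:R != 0 :> R by rewrite pnatr_eq0 -lt0n (leq_trans _ (ltn_ord i)).
have sw j b : a != b -> i != j -> M i a - M i b - M j a + M j b = 0.
  move=> ab ij.
  have [||//|s [sa sb]] := @perm_map_seq _ [:: a; b] [:: i; j].
  - by rewrite /= inE ab.
  - by rewrite /= inE ij.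
  have : \sum_x (M (s x) x - M ((s * tperm i j)%g x) x) = 0.
    by rewrite sumrB !Ms subrr.
  rewrite (bigD1 a) // (bigD1 b) 1?eq_sym //= !permM sa sb tpermL tpermR.
  rewrite big1 ?addr0; first by move=> e; rewrite -{}e; ring.
  move=> x /andP[xa xb]; rewrite permM tpermD ?subrr //.
    by rewrite -sa (inj_eq perm_inj) eq_sym.
  by rewrite -sb (inj_eq perm_inj) eq_sym.
have eqM b : M i b = M i a.
  have [->//|ab] := eqVneq a b.
  have : \sum_j (M i a - M i b - M j a + M j b) = 0.
    rewrite big1 // => j _; have [->|] := eqVneq i j; last exact: sw.
    by ring.
  rewrite !big_split /= !sumrN !Mc sumr_const sumr_const card_ord subr0 addr0.
  rewrite -mulrnBl -mulr_natl => /eqP; rewrite mulf_eq0 (negPf n0) /=.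
  by rewrite subr_eq0 => /eqP.
have := Mr i; rewrite (eq_bigr (fun=> M i a)) // sumr_const card_ord.
by rewrite -mulr_natl => /eqP; rewrite mulf_eq0 (negPf n0) => /eqP.
Qed.

End Transpositions.

(** * Traces, ranks and counting *)

Lemma mxtrace_gram_eq0 (R : realType) m k (M : 'M[R]_(m, k)) :
  \tr (M^T *m M) = 0 -> M = 0.
Proof.
move=> e; apply/matrixP => i j; rewrite mxE.
have p l : 0 <= (M^T *m M) l l.
  by rewrite mxE; apply: sumr_ge0 => x _; rewrite mxE -expr2 sqr_ge0.
have : (M^T *m M) j j = 0 by apply: psumr_eq0P e j _.
rewrite mxE => /psumr_eq0P h.
have : M^T j i * M i j = 0 by apply: h => // x _; rewrite mxE -expr2 sqr_ge0.
by rewrite mxE -expr2 => /eqP; rewrite sqrf_eq0 => /eqP.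
Qed.

(** The row spaces form a direct sum: if the rows of V lie in that of A_i and in the sum of the
    others, then V = Z A_i and V A_i = 0, so V V^T = V A_i Z^T = 0. *)
Lemma sum_rank_orthogonal (R : realType) m (I : finType) (A : I -> 'M[R]_m) :
  (forall i, (A i)^T = A i) -> (forall i j, i != j -> A i *m A j = 0) ->
  (\sum_i \rank (A i) <= m)%N.
Proof.
move=> At A0.
have /mxdirectP /= <- : mxdirect (\sum_i A i)%MS; last exact: rank_leq_col.
apply/mxdirect_sumsP => i _; apply/eqP; rewrite -submx0.
set V := (_ :&: _)%MS.
have /submxP[Z VZ] : (V <= A i)%MS by apply: capmxSl.
have VA : V *m A i = 0.
  apply/sub_kermxP; apply: submx_trans (capmxSr _ _) _.
  by apply/sumsmx_subP => j ji; apply/sub_kermxP; apply: A0.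
have : V^T = 0.
  apply: mxtrace_gram_eq0; rewrite trmxK {2}VZ trmx_mul At mulmxA VA mul0mx.
  exact: mxtrace0.
by move/(congr1 trmx); rewrite trmxK trmx0 => ->.
Qed.

Lemma count_le1 (T : eqType) (P : pred T) (s : seq T) : uniq s ->
  {in s &, forall x y, x != y -> ~~ P x \/ ~~ P y} -> (count P s <= 1)%N.
Proof.
move=> us h; rewrite -size_filter.
case E : (filter P s) (filter_uniq P us) => [|x [|y t]] //=.
rewrite inE negb_or => /andP[/andP[xy _] _].
have := mem_filter P x s; have := mem_filter P y s.
rewrite E !inE !eqxx orbT /= => /esym/andP[Py ys] /esym/andP[Px xs].
by have := h x y xs ys xy; rewrite Px Py; case.
Qed.

(** * The matrices Gamma and the zero discrepancy criterion *)

Section Gram.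
Variables (R : realType) (n : nat).
Hypothesis hn : (4 <= n)%N.
Implicit Types (w u : weight R n) (x y : 'I_n) (s : 'S_n).

(** Writing C_w for this matrix, Gamma_w = C_w^T C_w and K = C_w C_u^T. *)
Definition coordmx w : 'M[R]_(n, 2) :=
  \matrix_(x, j) if j == 0 then alpha w x 0 else beta w x 0.

Lemma Gamma_coordmx w : Gamma w = (coordmx w)^T *m coordmx w.
Proof.
have norm2E (a : 'cV[R]_n) : norm2 a ^+ 2 = \sum_i a i 0 ^+ 2.
  by rewrite sqr_sqrtr // sumr_ge0 // => i _; apply: sqr_ge0.
apply/matrixP => -[[|[|//]] ?] [[|[|//]] ?];
rewrite [RHS]mxE [LHS]mxE /= ?norm2E;
by apply: eq_bigr => x _; rewrite !mxE /= ?expr2 // mulrC.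
Qed.

Lemma gram_coordmx w u : gram w u = coordmx w *m (coordmx u)^T.
Proof.
apply/matrixP => x y.
by rewrite !mxE !big_ord_recl !big_ord0 !mxE /= !addr0.
Qed.

Lemma Gamma_tr w : (Gamma w)^T = Gamma w.
Proof. by rewrite Gamma_coordmx trmx_mul trmxK. Qed.

Lemma Gamma_mul w u : Gamma w *m Gamma u =
  (coordmx w)^T *m gram w u *m coordmx u.
Proof. by rewrite !Gamma_coordmx gram_coordmx !mulmxA. Qed.

(** By cyclicity of the trace the left side is tr(K^T K). *)
Lemma mxtrace_Gamma w u : \tr (Gamma w *m Gamma u) = 0 <-> gram w u = 0.
Proof.
split=> [e|e]; last by rewrite Gamma_mul e mulmx0 mul0mx mxtrace0.
apply: mxtrace_gram_eq0; rewrite -{}e Gamma_mul gram_coordmx.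
by rewrite trmx_mul trmxK [RHS]mxtrace_mulC !mulmxA.
Qed.

Lemma Gamma_mul_eq0 w u : \tr (Gamma w *m Gamma u) = 0 ->
  Gamma w *m Gamma u = 0.
Proof. by move/mxtrace_Gamma=> e; rewrite Gamma_mul e mulmx0 mul0mx. Qed.

Lemma vdotE m (a b : 'cV[R]_m) : vdot a b = (a^T *m b) 0 0.
Proof. by rewrite mxE; apply: eq_bigr => i _; rewrite mxE. Qed.

Lemma orthogonal_colspace w u : \tr (Gamma w *m Gamma u) = 0 <->
  orthogonal_sets (colspace (Gamma w)) (colspace (Gamma u)).
Proof.
split=> [/Gamma_mul_eq0 e _ _ [z ->] [z' ->]|o].
  by rewrite vdotE trmx_mul Gamma_tr mulmxA -(mulmxA z^T) e mulmx0 mul0mx mxE.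
suff -> : Gamma w *m Gamma u = 0 by apply: mxtrace0.
apply/matrixP => i j.
(* Unit vectors select columns, whose inner products are the entries of the product because the
   Gamma are symmetric. *)
have := o _ _ (ex_intro _ (delta_mx i 0) erefl)
  (ex_intro _ (delta_mx j 0) erefl).
rewrite vdotE trmx_mul Gamma_tr trmx_delta mulmxA -(mulmxA (delta_mx 0 i)).
by rewrite -rowE -colE !mxE.
Qed.

Lemma gramC w u x y : gram w u x y = gram u w y x.
Proof. by rewrite !gramE //; ring. Qed.

Lemma gram_rowsum w u x : centered u -> \sum_y gram w u x y = 0.
Proof.
move=> cu; under eq_bigr => y _ do rewrite gramE //.
by rewrite big_split /= -!mulr_sumr sum_pcoef // sum_qcoef !mulr0 addr0.
Qed.

(** Cross differences kill functions of the form f(x) + g(y), hence the degree parts. *)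
Lemma crossdiff_hpart w a b c d : uniq [:: a; b; c; d] ->
  crossdiff (wval (hpart w)) a b c d = crossdiff (wval w) a b c d.
Proof.
rewrite /= !inE !negb_or -!andbA => /and5P[_ ac ad bc /andP[bd _]].
by rewrite /crossdiff !wval_hpart //; ring.
Qed.

(** The symmetrization of h_w has zero row and column sums, and its cross differences are t + t'. *)
Lemma hplus_crossdiff w : centered w ->
  (forall a b c d, uniq [:: a; b; c; d] ->
    crossdiff (wval w) a b c d + crossdiff (wval w) c d a b = 0) ->
  hplus w = 0.
Proof.
move=> cw h; apply/hplus_eq0.
apply: (crossdiff_sym_eq0 hn) => [x|x|y|a b c d uq|x y]; last exact: addrC.
- by rewrite wval_diag addr0.
- by rewrite big_split /= hpart_rowsum // hpart_colsum // addr0.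
- by rewrite big_split /= hpart_rowsum // hpart_colsum // addr0.
- rewrite -(h _ _ _ _ uq) -!(crossdiff_hpart w) //;
    last by rewrite (uniq_catC [:: c; d] [:: a; b]).
  by rewrite /crossdiff; ring.
Qed.

Lemma hminus_crossdiff w : centered w ->
  (forall a b c d, uniq [:: a; b; c; d] ->
    crossdiff (wval w) a b c d - crossdiff (wval w) c d a b = 0) ->
  hminus w = 0.
Proof.
move=> cw h; apply/hminus_eq0 => x y; apply/eqP; rewrite -subr_eq0; apply/eqP.
move: x y; apply: (crossdiff_antisym_eq0 hn) => [x|y|a b c d uq|x y].
- by rewrite wval_diag subr0.
- by rewrite sumrB hpart_rowsum // hpart_colsum // subr0.
- rewrite -(h _ _ _ _ uq) -!(crossdiff_hpart w) //;
    last by rewrite (uniq_catC [:: c; d] [:: a; b]).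
  by rewrite /crossdiff; ring.
- by rewrite opprB.
Qed.

Lemma wdot_relabel_eq0 w u : centered w -> centered u ->
  (forall s, wdot (relabel s w) u = 0) <->
  [/\ hplus w = 0 \/ hplus u = 0, hminus w = 0 \/ hminus u = 0
    & gram w u = 0].
Proof.
move=> cw cu; split=> [e|[hp hm g0] s]; last first.
  rewrite wdot_relabel // hdot_eq0 // g0 addr0 big1 // => x _.
  by rewrite mxE.
pose t (v : weight R n) a b c d := crossdiff (wval v) a b c d.
have tt a b c d a' b' c' d' :
    uniq [:: a; b; c; d] -> uniq [:: a'; b'; c'; d'] ->
    t w a b c d * t u a' b' c' d' + t w c d a b * t u c' d' a' b' = 0.
  move=> uq uq'; apply: crossdiff_mul => //; first exact: wval_diag.
  move=> s; rewrite -[RHS](e s^-1%g) wdotE; apply: eq_bigr => x _.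
  by apply: eq_bigr => y _; rewrite wval_relabel invgK.
have tt' a b c d a' b' c' d' :
    uniq [:: a; b; c; d] -> uniq [:: a'; b'; c'; d'] ->
    t w a b c d * t u c' d' a' b' + t w c d a b * t u a' b' c' d' = 0.
  move=> uq uq'; apply: tt => //.
  by rewrite (uniq_catC [:: c'; d'] [:: a'; b']).
have hp : hplus w = 0 \/ hplus u = 0.
  (* One quadruple with a nonzero t + t' for u would force t + t' = 0 for w at every quadruple. *)
  have [h|nh] := pselect (hplus w = 0); [by left|right].
  apply: hplus_crossdiff => // a' b' c' d' uq'.
  apply: contra_notP nh => nz; apply: hplus_crossdiff => // a b c d uq.
  have : (t w a b c d + t w c d a b) * (t u a' b' c' d' + t u c' d' a' b') = 0.
    have := tt _ _ _ _ _ _ _ _ uq uq'; have := tt' _ _ _ _ _ _ _ _ uq uq'.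
    by lra.
  by move/eqP; rewrite mulf_eq0 => /orP[] /eqP.
have hm : hminus w = 0 \/ hminus u = 0.
  have [h|nh] := pselect (hminus w = 0); [by left|right].
  apply: hminus_crossdiff => // a' b' c' d' uq'.
  apply: contra_notP nh => nz; apply: hminus_crossdiff => // a b c d uq.
  have : (t w a b c d - t w c d a b) * (t u a' b' c' d' - t u c' d' a' b') = 0.
    have := tt _ _ _ _ _ _ _ _ uq uq'; have := tt' _ _ _ _ _ _ _ _ uq uq'.
    by lra.
  by move/eqP; rewrite mulf_eq0 => /orP[] /eqP.
split=> //; apply/matrixP => x y; rewrite [RHS]mxE; move: x y.
apply: perm_trace_eq0 => [s|x|y].
- by have := e s^-1%g; rewrite wdot_relabel // hdot_eq0 // addr0 invgK.
- exact: gram_rowsum.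
- under eq_bigr => x _ do rewrite gramC.
  exact: gram_rowsum.
Qed.

Lemma disc_eq0_iff w u : centered w -> centered u ->
  disc w u = 0 <->
  [/\ hplus w = 0 \/ hplus u = 0, hminus w = 0 \/ hminus u = 0
    & \tr (Gamma w *m Gamma u) = 0].
Proof.
move=> cw cu; rewrite disc_eq0 // wdot_relabel_eq0 //.
by split=> -[? ? ?]; split=> //; apply/mxtrace_Gamma.
Qed.

(** * Pairwise zero-discrepant families *)

Definition nparts w : nat :=
  \rank (Gamma w) + (hplus w != 0%R) + (hminus w != 0%R).

(** If Gamma_w = 0, the diagonal of K for the pair (w, w), a positive combination of p_x^2 and
    q_x^2, vanishes; then w = h_w = h_w^+ + h_w^-. *)
Lemma nparts_gt0 w : w != 0 -> (0 < nparts w)%N.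
Proof.
rewrite lt0n; apply: contra; rewrite !addn_eq0 !eqb0 !negbK mxrank_eq0.
case/andP=> /andP[/eqP G0 /eqP/hplus_eq0 hp] /eqP/hminus_eq0 hm.
have n4 := natr_ge4 R hn.
have g0 : gram w w = 0 by apply/mxtrace_Gamma; rewrite G0 mul0mx mxtrace0.
have pq x : pcoef w x = 0 /\ qcoef w x = 0.
  have : gram w w x x = 0 by rewrite g0 mxE.
  have a0 : 0 < 2 * (n%:R - 2) :> R by lra.
  have b0 : 0 < 2 * n%:R :> R by lra.
  rewrite gramE // -!expr2 => /eqP.
  rewrite (paddr_eq0 (mulr_ge0 (ltW a0) (sqr_ge0 _))
    (mulr_ge0 (ltW b0) (sqr_ge0 _))).
  rewrite (mulrI_eq0 _ (lregP (lt0r_neq0 a0))).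
  rewrite (mulrI_eq0 _ (lregP (lt0r_neq0 b0))).
  rewrite !sqrf_eq0.
  by case/andP=> /eqP -> /eqP ->.
apply/eqP; apply: wval_inj => x y xy; rewrite wval0.
have yx : y != x by rewrite eq_sym.
have := hp x y; have := hm x y; rewrite !wval_hpart //.
by case: (pq x) => -> ->; case: (pq y) => -> -> *; lra.
Qed.

(** Ranks contribute at most 2 and each indicator at most 1. Finite lists in F are used so that the
    bound can also prove F finite. *)
Lemma sum_nparts (F : set (weight R n)) (s : seq (weight R n)) :
  pairwise_zero_discrepant F -> (forall w, F w -> centered w) ->
  uniq s -> (forall w, w \in s -> F w) -> (\sum_(w <- s) nparts w <= 4)%N.
Proof.
move=> Fz Fc us sF.
have D w u : w \in s -> u \in s -> w != u ->
  [/\ hplus w = 0 \/ hplus u = 0, hminus w = 0 \/ hminus u = 0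
    & \tr (Gamma w *m Gamma u) = 0].
  by move=> /sF Fw /sF Fu wu; apply/disc_eq0_iff; auto.
have disj (P : pred (weight R n)) :
    (forall w u, w \in s -> u \in s -> w != u -> ~~ P w \/ ~~ P u) ->
    (\sum_(w <- s) P w <= 1)%N.
  by move=> h; rewrite -big_mkcond sum1_count; apply: count_le1.
rewrite !big_split /= (@leq_add _ _ 3 1) ?(@leq_add _ _ 2 1) //.
- rewrite (big_nth 0) big_mkord; apply: sum_rank_orthogonal => [i|i j ij].
    exact: Gamma_tr.
  by apply: Gamma_mul_eq0; case: (D s`_i s`_j) => //;
    rewrite ?mem_nth ?nth_uniq.
- apply: disj => w u ws us' wu; rewrite !negbK.
  by case: (D w u ws us' wu) => -[] ->; rewrite eqxx; auto.
- apply: disj => w u ws us' wu; rewrite !negbK.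
  by case: (D w u ws us' wu) => _ [] ->; rewrite eqxx; auto.
Qed.

End Gram.

(** * The criterion and the bound on families *)

Theorem theorem6p2 (R : realType) (n : nat) (hn : (4 <= n)%N) :
  (forall w u : weight R n, centered w -> centered u ->
     (disc w u = 0 <->
        [/\ hplus w = 0 \/ hplus u = 0,
            hminus w = 0 \/ hminus u = 0
          & \tr (Gamma w *m Gamma u) = 0])
     /\ (\tr (Gamma w *m Gamma u) = 0 <->
           orthogonal_sets (colspace (Gamma w)) (colspace (Gamma u))))
  /\
  (forall F : set (weight R n),
     pairwise_zero_discrepant F ->
     (forall w, F w -> w != 0 /\ centered w) ->
     [/\ finite_set F,
         (\big[addn/0]_(w \in F)
            (\rank (Gamma w) + (hplus w != 0%R) + (hminus w != 0%R)) <= 4)%N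
       & (F #<= `I_4)%card]).
Proof.
split=> [w u cw cu|F Fz Fc].
  by split; [apply: disc_eq0_iff|apply: orthogonal_colspace].
have bound s : uniq s -> (forall w, w \in s -> F w) ->
    (\sum_(w <- s) nparts w <= 4)%N.
  by apply: sum_nparts => // w /Fc[].
have size_bound s : uniq s -> (forall w, w \in s -> F w) -> (size s <= 4)%N.
  move=> us sF; apply: leq_trans (bound s us sF).
  rewrite -sum1_size !big_seq; apply: leq_sum => w /sF/Fc[w0 _].
  exact: nparts_gt0.
have Ffin : finite_set F.
  (* An infinite F would contain a finite subset with at least five elements. *)
  have [//|/(@infinite_set_fset _ _ 5)[B BF B5]] := pselect (finite_set F).
  have := size_bound _ (fset_uniq B) (fun w wB => BF w wB).
  by rewrite leqNgt B5.
have inF w : w \in fset_set F -> F w by rewrite in_fset_set // => /set_mem.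
split=> //.
  rewrite fsbig_finite //; exact: bound (fset_uniq _) inF.
have [k Fk] := Ffin.
rewrite (card_le_eql Fk) card_le_II -(card_fset_set Fk).
exact: size_bound (fset_uniq _) inF.
Qed.
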